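(* Let $T$ be a tree rooted at $o$ and let $f\in\mathcal{L}_{\mathbf{w},0}$ be such that there is $\delta>0$ with $|f(v)|\ge\delta$ for all $v\in T$. Then $f$ is a cyclic vector in $\mathcal{L}_{\mathbf{w},0}$.
   Context: A tree $T$ is a locally finite, connected, simply-connected graph, identified with its set of vertices; $T$ is assumed to have no terminal vertices (vertices with exactly one neighbor), so it is infinite, and it is rooted at a vertex $o$. $|v|$ is the number of edges in the unique path from $o$ to $v$; $T^*=T\setminus\{o\}$; for $v\in T^*$, $v^-$ is the neighbor of $v$ closest to $o$. For $f:T\to\mathbb{C}$ and $v\in T^*$, $Df(v)=|f(v)-f(v^-)|$. The weighted Lipschitz space $\mathcal{L}_{\mathbf{w}}$ is the set of $f:T\to\mathbb{C}$ with $\sup_{v\in T^*}|v|Df(v)<\infty$, normed by $\|f\|_{\mathbf{w}}=|f(o)|+\sup_{v\in T^*}|v|Df(v)$ (a Banach space). The little weighted Lipschitz space $\mathcal{L}_{\mathbf{w},0}$ is the closed subspace of those $f\in\mathcal{L}_{\mathbf{w}}$ with $\lim_{|v|\to\infty}|v|Df(v)=0$. For $v\in T$, the sector $S_v$ is the set consisting of $v$ and all its descendants (the vertices $w$ such that $v$ lies on the unique path from $o$ to $w$), and $p_v=\chi_{S_v}$ is its characteristic function. A function $f\in\mathcal{L}_{\mathbf{w},0}$ is a cyclic vector in $\mathcal{L}_{\mathbf{w},0}$ if the closure in $\mathcal{L}_{\mathbf{w},0}$ of the linear span of $\{p_vf: v\in T\}$ is all of $\mathcal{L}_{\mathbf{w},0}$.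 *)

(* Defs.v *)
From HB Require Import structures.
From mathcomp Require Import all_boot all_order all_algebra.
From mathcomp Require Import all_classical all_reals all_analysis.
From mathcomp Require Import complex.

Set Implicit Arguments.
Unset Strict Implicit.
Unset Printing Implicit Defensive.

Import Order.TTheory GRing.Theory Num.Theory.
Import numFieldNormedType.Exports.

Local Open Scope classical_set_scope.
Local Open Scope ring_scope.
Local Open Scope complex_scope.

(* [T_acyclic] is simple connectedness: a duplicate-free closed walk of length
   at least 3 is a cycle ([ucycle] also accepts [:: x; y] for an edge x -- y).
   [T_no_leaf] does not exclude the one-vertex graph, [T_infinite] does. *)
Record rootedTree := RootedTree {
  vertex :> choiceType;
  adj : rel vertex;
  root : vertex;
  adj_sym : symmetric adj;
  adj_irr : irreflexive adj;
  T_locally_finite : forall v, finite_set [set w | adj v w];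
  T_connected : forall v w, exists2 p, path adj v p & last v p = w;
  T_acyclic : forall c, ucycle adj c -> (size c <= 2)%N;
  T_no_leaf : forall v w, [set u | adj v u] <> [set w];
  T_infinite : infinite_set [set: vertex]
}.

Section tree.
Variable T : rootedTree.
Implicit Types (v w : T) (p q : seq T).
Local Notation e := (@adj T).
Local Notation o := (root T).

Definition simple_path v p w :=
  [&& path e v p, uniq (v :: p) & last v p == w].

(* the vertices following o on the path from o to v *)
Definition geod v : seq T := xget [::] [set p | simple_path o p v].

Definition depth v : nat := size (geod v).

Definition parent v : T :=
  xget o [set u | e v u /\ forall w, e v w -> (depth u <= depth w)%N].

Definition sector v : set T := [set w | v \in o :: geod w].

Lemma simple_path_uniq v w p q :
  simple_path v p w -> simple_path v q w -> p = q.
Proof.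
elim: p v q => [|a p IH] v q.
  move=> /and3P[_ _ /eqP /= ->]; case: q => // b q /and3P[_ /= + /eqP lq].
  by rewrite -{1}lq mem_last.
case: q => [|b q].
  by move=> + /and3P[_ _ /eqP /= wE]; move=> /and3P[_ /= + /eqP lp]; rewrite wE -lp mem_last.
move=> sp sq; have [ab|ab] := eqVneq a b.
  subst b; congr cons; apply: (IH a).
    by move: sp; rewrite /simple_path /= => /and3P[/andP[_ ->] /andP[_ ->] ->].
  by move: sq; rewrite /simple_path /= => /and3P[/andP[_ ->] /andP[_ ->] ->].
exfalso.
move: sp sq => /and3P[pp up /eqP lp] /and3P[pq uq /eqP lq].
have [t tE] : {t | t = b :: q} by exists (b :: q).
rewrite -tE in pq uq.
have hs : has (mem t) (a :: p).
  apply/hasP; exists w; first by rewrite -lp /= mem_last.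
  by rewrite /= tE -lq /= mem_last.
move: pp up lp ab => + + _.
set s := (a :: p) in hs *.
have -> : a = head v s by [].
move: hs => /split_find[c p1 p2 cq np1].
have -> : b = head v t by rewrite tE.
have {}cq : c \in t := cq.
rewrite cat_rcons => pp up hd.
move: {tE} pq uq np1 hd; case/splitPr: cq => q1 q2 pq uq np1 hd.
have cyc : ucycle e (v :: p1 ++ c :: rev q1).
  apply/andP; split.
    rewrite /= rcons_cat /= cat_path /=.
    move: pp; rewrite cat_path /= => /and3P[-> -> _] /=.
    move: pq; rewrite -cat_rcons cat_path => /andP[pq _].
    have := rev_path e v (rcons q1 c).
    rewrite last_rcons belast_rcons rev_cons => pr.
    by rewrite pr (eq_path (e' := e)) // => x y; rewrite adj_sym.
  move: up; rewrite !cons_uniq -cat_rcons mem_cat cat_uniq => /and3P[].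
  rewrite negb_or => /andP[vp1 _] up1 _.
  move: uq; rewrite cons_uniq -cat_rcons mem_cat cat_uniq => /and3P[].
  rewrite negb_or => /andP[vq1 _] uq1 _.
  rewrite -cat_rcons cat_uniq mem_cat (negbTE vp1) /= mem_rev.
  move: vq1; rewrite mem_rcons inE negb_or => /andP[_ ->] /=.
  rewrite up1 rev_uniq /=.
  move: uq1; rewrite rcons_uniq => /andP[cq1 ->]; rewrite andbT.
  rewrite has_rev; apply/hasPn => x xq1; rewrite mem_rcons inE negb_or.
  apply/andP; split; first by apply: contraNneq cq1 => <-.
  apply: contra np1 => xp1; apply/hasP; exists x => //=.
  by rewrite mem_cat xq1.
have := T_acyclic cyc.
rewrite /= size_cat /= size_rev.
by case: p1 q1 hd {cyc np1 pp up pq uq} => [|? ?] [|? ?] //=; rewrite ?eqxx ?addnS.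
Qed.

Lemma geodP v : simple_path o (geod v) v.
Proof.
rewrite /geod; case: xgetP => [p _ //|np]; exfalso.
have [p pp lp] := T_connected o v.
case/shortenP: pp lp => q pq uq _ lq; apply: (np q).
by apply/and3P; split => //; apply/eqP.
Qed.

Lemma geod_eq v p : simple_path o p v -> geod v = p.
Proof. by move=> h; apply: simple_path_uniq (geodP v) h. Qed.

Lemma geod_root : geod o = [::].
Proof. by apply: geod_eq; rewrite /simple_path /= eqxx. Qed.

Lemma geod_rcons p v : geod v = rcons p v ->
  forall w, e v w -> w = last o p \/ (depth v < depth w)%N.
Proof.
move=> gv w vw; have /and3P[pw uw /eqP lw] := geodP w.
have [vin|vnin] := boolP (v \in o :: geod w); [right|left].
  have vw' : v != w by apply: contraTneq vw => ->; rewrite adj_irr.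
  rewrite /depth; case/splitPl: vin pw uw lw => p1 p2 l1.
  rewrite cat_path -cat_cons cat_uniq last_cat.
  move=> /andP[pp1 _] /and3P[up1 _ _] lw.
  have -> : geod v = p1.
    by apply: geod_eq; apply/and3P; split => //; rewrite l1.
  rewrite size_cat; case: p2 lw => [|x p2] /= lw.
    by move: vw'; rewrite -l1 lw eqxx.
  by rewrite addnS ltnS leq_addr.
have : geod v = rcons (geod w) v.
  apply: geod_eq; apply/and3P; split; rewrite ?last_rcons //.
    by rewrite rcons_path pw lw adj_sym.
  by rewrite -rcons_cons rcons_uniq vnin.
by rewrite gv => /rcons_inj[->]; rewrite lw.
Qed.

Lemma geod_parent v : v != o ->
  e v (parent v) /\ geod v = rcons (geod (parent v)) v.
Proof.
move=> vo; have /and3P[] := geodP v.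
case/lastP gv : (geod v) => [|p z] pp up /eqP.
  by move=> /= vE; rewrite vE eqxx in vo.
rewrite last_rcons => zv; subst z.
move: pp; rewrite rcons_path => /andP[pp ev].
have gu : geod (last o p) = p.
  apply: geod_eq; apply/and3P; split => //.
  by move: up; rewrite -rcons_cons rcons_uniq => /andP[].
have H := geod_rcons gv.
have du : (depth (last o p) < depth v)%N by rewrite /depth gu gv size_rcons.
suff -> : parent v = last o p by rewrite adj_sym ev gu.
rewrite /parent; case: xgetP => [u _ [vu umin]|/(_ (last o p))[]].
  have [//|dv] := H _ vu.
  have := umin (last o p); rewrite adj_sym => /(_ ev) h.
  by have := leq_trans (ltn_trans du dv) h; rewrite ltnn.
split; first by rewrite adj_sym.
by move=> w /H[->//|dw]; exact: ltnW (ltn_trans du dw).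
Qed.

Lemma depth_parent v : v != o -> depth v = (depth (parent v)).+1.
Proof. by move=> /geod_parent[_ h]; rewrite /depth h size_rcons. Qed.

Lemma sector_parent v w : w != o -> w != v ->
  (w \in sector v) = (parent w \in sector v).
Proof.
move=> wo wv; have [_ h] := geod_parent wo.
have -> : (w \in sector v) = (v \in o :: geod w).
  by apply/idP/idP; rewrite inE.
have -> : (parent w \in sector v) = (v \in o :: geod (parent w)).
  by apply/idP/idP; rewrite inE.
by rewrite h !inE mem_rcons inE eq_sym [v == w]eq_sym (negbTE wv).
Qed.

End tree.

Section lipschitz.
Variables (T : rootedTree) (R : realType).
Local Notation C := R[i].
Local Notation o := (root T).
Local Notation normc := ComplexField.Normc.normc.
Implicit Types (f g : T -> C^o) (v w : T).

Lemma modulusD (x y : C) : normc (x + y) <= normc x + normc y.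
Proof. exact: le_normcD. Qed.

Lemma modulus_ge0 (x : C) : 0 <= normc x.
Proof. by case: x => a b /=; exact: sqrtr_ge0. Qed.
#[local] Hint Resolve modulus_ge0 : core.

Definition Tstar : set T := [set v | v != o].

(* only meaningful for v in Tstar *)
Definition D f v : R := normc (f v - f (parent v)).

Definition wD f v : R := (depth v)%:R * D f v.

Definition lip_w : set (T -> C^o) := [set f | has_ubound (wD f @` Tstar)].

Definition norm_w f : R := normc (f o) + sup (wD f @` Tstar).

Definition little_lip_w : set (T -> C^o) := [set f | lip_w f /\
  forall eps : R, 0 < eps ->
    exists N, forall v, Tstar v -> (N <= depth v)%N -> wD f v < eps].

Definition in_little_lip_w : {pred T -> C^o} := mem little_lip_w.

Lemma wD_ge0 f v : 0 <= wD f v.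
Proof. by rewrite mulr_ge0// modulus_ge0. Qed.
#[local] Hint Resolve wD_ge0 : core.

Lemma wD_lin (a : C) f g v : wD (a *: f + g) v <= normc a * wD f v + wD g v.
Proof.
rewrite /wD [normc a * _]mulrCA -mulrDr ler_wpM2l// /D.
rewrite -ComplexField.Normc.normcM.
apply: le_trans (modulusD _ _).
by rewrite mulrBr opprD addrACA.
Qed.

Lemma Tstar_neq0 : Tstar !=set0.
Proof.
apply: contrapT => h; apply: (@T_infinite T).
apply: (@sub_finite_set _ _ [set o]); last exact: finite_set1.
by move=> v _; apply: contrapT => vo; apply: h; exists v; apply/eqP.
Qed.

Lemma has_sup_wD f : lip_w f -> has_sup (wD f @` Tstar).
Proof. by split => //; case: Tstar_neq0 => v vT; exists (wD f v), v. Qed.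

Lemma le_sup_wD f v : lip_w f -> Tstar v -> wD f v <= sup (wD f @` Tstar).
Proof. by move=> fl vT; apply: ub_le_sup => //; exists v. Qed.

Lemma sup_wD_le f (x : R) :
  (forall v, Tstar v -> wD f v <= x) -> sup (wD f @` Tstar) <= x.
Proof.
move=> h; apply: ge_sup => [|_ [v vT <-]]; last exact: h.
by case: Tstar_neq0 => v vT; exists (wD f v), v.
Qed.

Lemma little_lip_w_submod_closed : submod_closed in_little_lip_w.
Proof.
split=> [|a f g].
  have h v : wD (0 : T -> C^o) v = 0.
    by rewrite /wD /D subrr ComplexField.Normc.normc0 mulr0.
  apply/mem_set; split; first by exists 0 => _ [v _ <-]; rewrite h.
  by move=> eps e0; exists 0%N => v _ _; rewrite h.
move=> /set_mem[lf f0] /set_mem[lg g0]; apply/mem_set; split.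
  exists (normc a * sup (wD f @` Tstar) + sup (wD g @` Tstar)) => _ [v vT <-].
  by rewrite (le_trans (wD_lin _ _ _ _))// lerD// ?ler_wpM2l// le_sup_wD.
move=> eps e0; have a1 : 0 < normc a + 1 by rewrite ltr_wpDl.
have [|N1 h1] := f0 (eps / 2 / (normc a + 1)); first by rewrite !divr_gt0.
have [|N2 h2] := g0 (eps / 2); first by rewrite divr_gt0.
exists (maxn N1 N2) => v vT; rewrite geq_max => /andP[/(h1 _ vT) l1 /(h2 _ vT) l2].
rewrite (le_lt_trans (wD_lin _ _ _ _))// [eps]splitr ler_ltD//.
apply: (@le_trans _ _ ((normc a + 1) * wD f v)).
  by rewrite ler_wpM2r// lerDl.
by rewrite mulrC -ler_pdivlMr// ltW.
Qed.

HB.instance Definition _ := GRing.isSubmodClosed.Build C (T -> C^o)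
  in_little_lip_w little_lip_w_submod_closed.

Record little_lip := LittleLip {
  lip_fun :> T -> C^o;
  lip_funP : lip_fun \in in_little_lip_w
}.

HB.instance Definition _ := [isSub for lip_fun].
HB.instance Definition _ := [Choice of little_lip by <:].
HB.instance Definition _ := [SubChoice_isSubLmodule of little_lip by <:].

Implicit Types F G : little_lip.

Lemma lip_w_lip F : lip_w F. Proof. by have /set_mem[] := lip_funP F. Qed.
#[local] Hint Resolve lip_w_lip : core.

Lemma little_lipP F : little_lip_w F.
Proof. exact: set_mem (lip_funP F). Qed.

Lemma sup_wD_ge0 F : 0 <= sup (wD F @` Tstar).
Proof.
case: Tstar_neq0 => v vT.
exact: le_trans (wD_ge0 F v) (le_sup_wD (lip_w_lip F) vT).
Qed.

(* MathComp-Analysis normed modules over C have a C-valued norm *)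
Definition norm_lip F : C := (norm_w F)%:C.

Lemma norm_lipD F G : norm_lip (F + G) <= norm_lip F + norm_lip G.
Proof.
rewrite /norm_lip -rmorphD/= lecR /norm_w addrACA lerD//; first exact: modulusD.
apply: sup_wD_le => v vT; have := wD_lin 1 F G v.
rewrite scale1r ComplexField.Normc.normc1 mul1r => /le_trans; apply.
by rewrite lerD//; exact: le_sup_wD.
Qed.

Lemma norm_lipZ (a : C) F : norm_lip (a *: F) = `|a| * norm_lip F.
Proof.
have wDZ v : wD (a *: F : little_lip) v = normc a * wD F v.
  by rewrite /wD mulrCA /D -ComplexField.Normc.normcM mulrBr.
have -> : `|a| = (normc a)%:C by [].
rewrite /norm_lip -rmorphM/=; congr (_%:C).
rewrite /norm_w mulrDr; congr (_ + _); first exact: ComplexField.Normc.normcM.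
apply/eqP; rewrite eq_le; apply/andP; split.
  by apply: sup_wD_le => v vT; rewrite wDZ ler_wpM2l//; exact: le_sup_wD.
have [->|a0] := eqVneq (normc a) 0; first by rewrite mul0r; exact: (sup_wD_ge0 (a *: F)).
have a1 : 0 < normc a by rewrite lt_def a0 modulus_ge0.
rewrite mulrC -ler_pdivlMr//; apply: sup_wD_le => v vT.
by rewrite ler_pdivlMr// mulrC -wDZ; exact: le_sup_wD.
Qed.

Lemma norm_lip_eq0 F : norm_lip F = 0 -> F = 0.
Proof.
move=> [/eqP]; rewrite /norm_w paddr_eq0 ?sup_wD_ge0// => /andP[/eqP fo /eqP s0].
apply/val_inj/funext => v /=.
have [n] := ubnP (depth v); elim: n v => // n IH v dv.
have [->|vo] := eqVneq v o; first exact: ComplexField.Normc.eq0_normc.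
have dp := depth_parent vo.
have /eqP : wD F v = 0.
  by apply/eqP; rewrite eq_le wD_ge0 andbT -s0; exact: le_sup_wD.
rewrite mulf_eq0 pnatr_eq0 dp/= => /eqP/ComplexField.Normc.eq0_normc/eqP.
by rewrite subr_eq0 => /eqP ->; apply: IH; rewrite -ltnS -dp.
Qed.

HB.instance Definition _ := @Lmodule_isNormed.Build C little_lip
  norm_lip norm_lipD norm_lipZ norm_lip_eq0.

Lemma norm_lipE F : `|F| = (norm_w F)%:C. Proof. by []. Qed.

Definition p_mul v f : T -> C^o := fun w => (\1_(sector v) w : C) * f w.

Lemma p_mul_subproof v F : p_mul v F \in in_little_lip_w.
Proof.
have le_wD w : Tstar w -> w != v -> wD (p_mul v F) w <= wD F w.
  move=> wo wv; rewrite /wD ler_wpM2l// /D /p_mul !indicE (sector_parent wo wv).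
  case: (_ \in _); first by rewrite !mul1r.
  by rewrite !mul0r subrr ComplexField.Normc.normc0.
have /set_mem[lF F0] := lip_funP F; apply/mem_set; split.
  exists (Num.max (wD (p_mul v F) v) (sup (wD F @` Tstar))) => _ [w wT <-].
  rewrite le_max; have [->|wv] := eqVneq w v; first by rewrite lexx.
  by apply/orP; right; apply: le_trans (le_wD _ wT wv) _; exact: le_sup_wD.
move=> eps /F0[N hN]; exists (maxn N (depth v).+1) => w wT.
rewrite geq_max => /andP[Nw vw]; apply: le_lt_trans (hN _ wT Nw).
by apply: le_wD => //; apply: contraTneq vw => ->; rewrite ltnn.
Qed.

Definition p_mul_lip v F : little_lip := LittleLip (p_mul_subproof v F).

End lipschitz.

Definition lin_span (K : nzRingType) (V : lmodType K) (A : set V) : set V :=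
  [set x | exists n (a : 'I_n -> K) (u : 'I_n -> V),
    (forall i, A (u i)) /\ x = \sum_(i < n) a i *: u i].

Definition cyclic_vector (T : rootedTree) (R : realType) (F : little_lip T R) :=
  closure (lin_span [set p_mul_lip v F | v in [set: T]]) = setT.

(* Main.v *)
(* Truncate [g] at a level [N], making it constant on the sectors below that
   level. The truncation [gN] is bounded, even though [g] need not be, hence so
   is [gN / f]. Truncating [gN / f] at a level [m >= N] gives a finite
   combination [phi] of the [p_v], and [phi * f - g] vanishes up to level [N],
   has the increments of [- g] between levels [N] and [m], and has increments
   of size at most [Dg + sup |gN / f| * Df] beyond level [m]. These are
   uniformly small in the weighted norm because [f] and [g] are in the little
   space. *)
Require Import Defs.
From mathcomp Require Import all_boot all_order all_algebra.
From mathcomp Require Import all_classical all_reals all_analysis.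
From mathcomp Require Import complex.
From mathcomp Require Import ring.

Import Order.TTheory GRing.Theory Num.Theory.
Local Open Scope ring_scope.

Section truncation.
Local Open Scope classical_set_scope.
Variable T : rootedTree.
Implicit Types v w : T.
Local Notation o := (Defs.root T).

Lemma depth_root : depth o = 0%N.
Proof. by rewrite /depth geod_root. Qed.

Lemma depth_ind (P : T -> Prop) :
  P o -> (forall v, v != o -> P (parent v) -> P v) -> forall v, P v.
Proof.
move=> Po Pv v; have [n] := ubnP (depth v); elim: n v => // n IH v.
have [-> //|vo] := eqVneq v o.
by rewrite (depth_parent vo) ltnS => dv; exact/Pv/IH.
Qed.

(** By induction on the level: a vertex at depth at most [n.+1] is [o] or a neighbour of its parent,
    which has depth at most [n], and neighbourhoods are finite. *)
Lemma finite_depth_le n : finite_set [set v : T | (depth v <= n)%N].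
Proof.
elim: n => [|n IH].
  apply: (@sub_finite_set _ _ [set o]); last exact: finite_set1.
  move=> v /=; have [-> //|vo] := eqVneq v o.
  by rewrite (depth_parent vo).
apply: (@sub_finite_set _ _ ([set o] `|`
    \bigcup_(u in [set v : T | (depth v <= n)%N]) [set w | adj u w])).
  move=> v /=; have [->|vo] := eqVneq v o; first by left.
  rewrite (depth_parent vo) ltnS => dv; right; exists (parent v) => //=.
  by rewrite adj_sym; have [] := geod_parent vo.
rewrite finite_setU; split; first exact: finite_set1.
by apply: bigcup_finite => // u _; exact: T_locally_finite.
Qed.

Lemma sectorE v w : (w \in sector v) = (v \in o :: geod w).
Proof. by apply/idP/idP; rewrite inE. Qed.

Lemma sector_root v : (o \in sector v) = (v == o).
Proof. by rewrite sectorE geod_root inE. Qed.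

Lemma sector_self v : v \in sector v.
Proof.
rewrite sectorE; have [->|vo] := eqVneq v o; first by rewrite inE eqxx.
by have [_ ->] := geod_parent vo; rewrite inE mem_rcons mem_head orbT.
Qed.

Lemma parent_notin_sector v : v != o -> parent v \notin sector v.
Proof.
move=> vo; rewrite sectorE; have [_ gv] := geod_parent vo.
have /and3P[_ + _] := geodP v.
by rewrite gv -rcons_cons rcons_uniq => /andP[].
Qed.

Variable C : comNzRingType.

(** The sectors containing [w] are those of the vertices on the path from [o] to [w]. With the
    increments of [psi] as coefficients, the sum telescopes along this path, stopping at level
    [n]. *)
Lemma sector_combination (psi : T -> C) n :
  exists (s : seq T) (a : T -> C), let phi w := \sum_(v <- s) a v * \1_(sector v) w in
  (forall w, (depth w <= n)%N -> phi w = psi w) /\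
  (forall w, (n < depth w)%N -> phi w = phi (parent w)).
Proof.
have [s0 sE] := (finite_seqP _).1 (finite_depth_le n).
pose s := undup s0.
have us : uniq s by exact: undup_uniq.
have memsE v : (v \in s) = (depth v <= n)%N.
  rewrite mem_undup; have /= := congr1 (fun A : set T => A v) sE.
  by move=> h; apply/idP/idP; rewrite h.
pose a v := if v == o then psi o else psi v - psi (parent v).
exists s, a; move=> phi.
have phi_o : phi o = psi o.
  rewrite /phi (bigD1_seq o) ?memsE ?depth_root //= big1 => [|v vo].
    by rewrite addr0 /a eqxx indicE sector_self mulr1.
  by rewrite indicE sector_root (negbTE vo) mulr0.
(* Crossing the edge from [parent w] to [w] changes the indicator of [sector w] only. *)
have out w v : w != o -> v != w -> \1_(sector v) w = \1_(sector v) (parent w) :> C.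
  by move=> wo vw; rewrite !indicE (sector_parent wo) // eq_sym.
have phi_out w : (n < depth w)%N -> phi w = phi (parent w).
  move=> nw; have wo : w != o by apply: contraTneq nw => ->; rewrite depth_root.
  rewrite /phi; apply: eq_big_seq => v; rewrite memsE => vn.
  by rewrite out //; apply: contraTneq vn => ->; rewrite -ltnNge.
split => //; elim/depth_ind => // w wo IH wn.
have pwn : (depth (parent w) <= n)%N.
  by rewrite (leq_trans _ wn) // (depth_parent wo).
have ws : w \in s by rewrite memsE.
(* The term of [w] vanishes at [parent w], so the other terms add up to [psi (parent w)] there,
   hence also at [w]. *)
have /eqP := IH pwn; rewrite /phi (bigD1_seq w ws us) /=.
rewrite indicE (negbTE (parent_notin_sector _ wo)) mulr0 add0r => /eqP IHw.
rewrite (bigD1_seq w ws us) /= indicE sector_self mulr1.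
under eq_bigr => v vw do rewrite out //.
by rewrite IHw /a (negbTE wo) subrK.
Qed.

(** Every value of [phi] is a value of [psi] at depth at most [n], found by moving up to an
    ancestor. *)
Lemma truncation_bounded (K : numDomainType) (N : C -> K) (M : K) n (psi phi : T -> C) :
  (forall w, (depth w <= n)%N -> N (psi w) <= M) ->
  (forall w, (depth w <= n)%N -> phi w = psi w) ->
  (forall w, (n < depth w)%N -> phi w = phi (parent w)) ->
  forall w, N (phi w) <= M.
Proof.
move=> psiM phi_in phi_out; elim/depth_ind => [|w _ IH].
  by rewrite phi_in ?psiM // depth_root.
by have [wn|nw] := leqP (depth w) n; [rewrite phi_in ?psiM|rewrite phi_out].
Qed.

End truncation.

Section density.
Variables (R : realType) (T : rootedTree).
Local Notation C := R[i].
Local Notation o := (Defs.root T).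
Local Notation normc := ComplexField.Normc.normc.
Implicit Types (F G H : little_lip T R) (v w : T).

Lemma lin_span_sum F (s : seq T) (a : T -> C) :
  lin_span [set p_mul_lip v F | v in [set: T]]%classic
    (\sum_(v <- s) a v *: p_mul_lip v F).
Proof.
exists (size s), (fun i => a (tnth (in_tuple s) i)),
  (fun i => p_mul_lip (tnth (in_tuple s) i) F); split.
  by move=> i; exists (tnth (in_tuple s) i).
by rewrite big_tnth.
Qed.

Lemma sum_p_mulE F (s : seq T) (a : T -> C) w :
  (\sum_(v <- s) a v *: p_mul_lip v F : little_lip T R) w =
  (\sum_(v <- s) a v * \1_(sector v) w) * F w.
Proof.
elim: s => [|v s IH]; first by rewrite !big_nil mul0r.
by rewrite !big_cons mulrDl -IH -mulrA.
Qed.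

(** The path from [o] to [v] has [depth v] edges, and the weight of each is at least 1, so each
    increment is at most the supremum of the weighted ones. *)
Lemma normc_depth_le G n v : (depth v <= n)%N ->
  normc (G v) <= normc (G o) + sup (wD G @` @Tstar T)%classic *+ n.
Proof.
have S0 := sup_wD_ge0 G; set S := sup _ in S0 *.
move=> vn; apply: (@le_trans _ _ (normc (G o) + S *+ depth v)).
  elim/depth_ind: v {vn} => [|v vo IH]; first by rewrite depth_root addr0.
  have -> : G v = G (parent v) + (G v - G (parent v)) by rewrite addrC subrK.
  rewrite (le_trans (modulusD _ _)) // (depth_parent vo) mulrSr addrA lerD //.
  rewrite (le_trans _ (le_sup_wD (lip_w_lip G) vo)) // /wD ler_peMl ?modulus_ge0 //.
  by rewrite ler1n (depth_parent vo).
by rewrite lerD2l ler_wpMn2l.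
Qed.

Lemma lin_span_approx F G (delta eps : R) : 0 < delta ->
  (forall v, delta <= normc (F v)) -> 0 < eps ->
  exists2 H, lin_span [set p_mul_lip v F | v in [set: T]]%classic H &
    norm_w (G - H) <= eps.
Proof.
move=> d0 Fd e0.
have e20 : 0 < eps / 2 by rewrite divr_gt0.
have [_ /(_ _ e20)[N GN]] := little_lipP G.
have [s [a]] := sector_combination _ _ G N; set gN := (fun w => _) => -[gN_in gN_out].
set M := normc (G o) + sup (wD G @` @Tstar T)%classic *+ N.
have gN_M : forall w, normc (gN w) <= M.
  by apply: (truncation_bounded _ _ _ _ _ N G) => // w; exact: normc_depth_le.
have M0 : 0 <= M by exact: le_trans (modulus_ge0 _) (gN_M o).
have M1 : 0 < M + 1 by rewrite ltr_wpDl.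
(* This bound, multiplied by the bound [M / delta] on [gN / F], gives at most [eps / 2]; the
   denominator [M + 1] is positive even when [M = 0]. *)
have [|m0 Fm] := (little_lipP F).2 (eps / 2 * delta / (M + 1)).
  by rewrite divr_gt0 // mulr_gt0.
pose m := maxn N m0.
pose q w : C := gN w / F w.
have F0 w : F w != 0.
  by apply: contraTneq (Fd w) => ->; rewrite ComplexField.Normc.normc0 -ltNge.
have q_M w : normc (q w) <= M / delta.
  rewrite /q ComplexField.Normc.normcM ComplexField.Normc.normcV //.
  rewrite ler_pM ?invr_ge0 ?modulus_ge0 // lef_pV2 ?posrE //.
  exact: lt_le_trans (Fd w).
have [s' [b]] := sector_combination _ _ q m; set phi := (fun w => _) => -[phi_in phi_out].
have phi_M : forall w, normc (phi w) <= M / delta.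
  by apply: (truncation_bounded _ _ _ _ _ m q) => // w _; exact: q_M.
exists (\sum_(v <- s') b v *: p_mul_lip v F); first exact: lin_span_sum.
set H := \sum_(v <- s') _.
have HE w : H w = phi w * F w by exact: sum_p_mulE.
have H_in w : (depth w <= m)%N -> H w = gN w.
  by move=> wm; rewrite HE phi_in // /q divfK.
have Ho : (G - H : little_lip T R) o = 0.
  change (G o - H o = 0).
  by rewrite H_in ?depth_root // gN_in ?depth_root // subrr.
rewrite /norm_w Ho ComplexField.Normc.normc0 add0r; apply: sup_wD_le => v vo.
have dv := depth_parent vo.
have pv k : (depth v <= k)%N -> (depth (parent v) <= k)%N.
  by move=> vk; rewrite (leq_trans _ vk) // dv.
have [vN|Nv] := leqP (depth v) N.
  have GH w : (depth w <= N)%N -> (G - H : little_lip T R) w = 0.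
    move=> wN; change (G w - H w = 0).
    by rewrite H_in ?gN_in ?subrr // (leq_trans wN) // leq_maxl.
  by rewrite /wD /D !GH ?pv // subrr ComplexField.Normc.normc0 mulr0 ltW.
(* Beyond level [N] the increments of [G] cost at most [eps / 2], which leaves those of [H]. *)
suff HD : wD H v <= eps / 2.
  have -> : (G - H : little_lip T R) = (-1) *: H + G by rewrite scaleN1r addrC.
  rewrite (le_trans (wD_lin _ _ _ _)) // [eps]splitr lerD //.
    by rewrite normcN ComplexField.Normc.normc1 mul1r.
  exact/ltW/GN/ltnW.
have [vm|mv] := leqP (depth v) m.
  rewrite /wD /D !H_in ?pv // gN_out // subrr.
  by rewrite ComplexField.Normc.normc0 mulr0 ltW.
(* Beyond level [m] the factor [phi] is constant along the edge and comes out of the increment of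
   [phi * F]. *)
have -> : wD H v = normc (phi v) * wD F v.
  by rewrite /wD /D !HE -phi_out // -mulrBr ComplexField.Normc.normcM mulrCA.
have wF : wD F v <= eps / 2 * delta / (M + 1).
  by apply/ltW/Fm => //; rewrite (leq_trans _ (ltnW mv)) // leq_maxr.
rewrite (le_trans (ler_pM (modulus_ge0 _) (wD_ge0 _ _) (phi_M v) wF)) //.
have -> : M / delta * (eps / 2 * delta / (M + 1)) = eps / 2 * (M / (M + 1)).
  by field; rewrite !gt_eqF.
rewrite ler_piMr ?(ltW e20) // ler_pdivrMr // mul1r lerDl //.
Qed.

End density.

Theorem theorem3p2 (R : realType) (T : rootedTree) (f : little_lip T R)
    (hf : exists delta : R, 0 < delta /\
       forall v : T, delta <= ComplexField.Normc.normc (f v)) :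
  cyclic_vector f.
Proof.
have [delta [d0 fd]] := hf.
rewrite /cyclic_vector -subTset => g _ B /nbhs_ballP[e e0 eB].
(* The radius lives in [R[i]], where being positive means being real and positive. *)
have [eI eR] : complex.Im e = 0 /\ 0 < complex.Re e.
  by move: e0; rewrite /= ltcE /= => /andP[/eqP].
(* Halving the radius turns the non-strict estimate into membership in the open ball. *)
have [|h hs gh] := lin_span_approx _ _ f g delta (complex.Re e / 2) d0 fd.
  by rewrite divr_gt0.
exists h; split => //; apply: eB; rewrite -ball_normE /= norm_lipE.
rewrite ltcE /= eI eqxx /= (le_lt_trans gh) //.
by rewrite ltr_pdivrMr // ltr_pMr // ltr1n.
Qed.
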